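(* Let $n_1,n_2\ge1$ be two integers, $\Omega_1$ be a bounded and open subset of $\mathbb{R}^{n_1}$, $\Omega_2$ be a bounded, open, nonempty, and smooth subset of $\mathbb{R}^{n_2}$, and $\Omega:=\Omega_1\times\Omega_2$. Let $F$ be a real-valued $C^2$-function in a neighborhood of $\overline\Omega$ such that (i) the outward normal derivative of $F$ on $\Omega_1\times\partial\Omega_2$ is positive; (ii) there exists $\overline{x}\in\Omega_1$ such that $\displaystyle\inf_{\Omega_2}F(\overline{x},\cdot)>\sup_{\partial\Omega_1\times\Omega_2}F$. Then $F$ has a critical point in (the interior of) $\Omega$.
   Context: A ''smooth'' open subset of $\mathbb{R}^{n_2}$ is one with smooth boundary. The outward normal derivative of $F$ at a point $(x_1,x_2)\in\Omega_1\times\partial\Omega_2$ is $\langle\nabla F(x_1,x_2),\nu\rangle$ with $\nu=(0,\nu_2(x_2))\in\mathbb{R}^{n_1}\times\mathbb{R}^{n_2}$, where $\nu_2(x_2)$ is the outward unit normal to $\partial\Omega_2$ at $x_2$. *)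

(* Defs.v *)
From HB Require Import structures.
From mathcomp Require Import all_boot all_order all_algebra.
From mathcomp Require Import all_classical all_reals all_analysis.
Import Order.TTheory GRing.Theory Num.Theory.
Import numFieldNormedType.Exports.

Set Implicit Arguments.
Unset Strict Implicit.
Unset Printing Implicit Defensive.

Local Open Scope classical_set_scope.
Local Open Scope ring_scope.

Definition dotp {R : realType} {n : nat} (u v : 'rV[R]_n) : R :=
  \sum_(i < n) u 0 i * v 0 i.

(* Euclidean norm; the library norm `|u| on row vectors is the sup norm. *)
Definition enorm {R : realType} {n : nat} (u : 'rV[R]_n) : R :=
  Num.sqrt (dotp u u).

Definition grad {R : realType} {n : nat} (f : 'rV[R]_n -> R) (x : 'rV[R]_n) :
  'rV[R]_n := \row_(i < n) 'D_(delta_mx 0 i) f x.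

(* f is of class C^k on the set U; meant for open U, so that only the values
   of f on U matter. *)
Fixpoint is_Ck {R : realType} {n : nat} (k : nat) (U : set 'rV[R]_n)
    (f : 'rV[R]_n -> R) : Prop :=
  match k with
  | 0%N => forall x, U x -> {for x, continuous f}
  | k'.+1 => (forall x, U x -> differentiable f x) /\
             (forall i : 'I_n, is_Ck k' U (fun x => 'D_(delta_mx 0 i) f x))
  end.

Definition boundary {T : topologicalType} (A : set T) : set T :=
  closure A `\` interior A.

(* Near p, the set Omega is {rho < 0} with rho of class C^oo and without
   critical point. *)
Definition local_defining_function {R : realType} {n : nat}
    (Omega : set 'rV[R]_n) (p : 'rV[R]_n) (rho : 'rV[R]_n -> R) : Prop :=
  exists U : set 'rV[R]_n,
    [/\ open U, U p, (forall k, is_Ck k U rho),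
        (forall x, U x -> grad rho x <> 0) &
        Omega `&` U = [set x | rho x < 0] `&` U].

Definition smooth_boundary {R : realType} {n : nat} (Omega : set 'rV[R]_n) :
    Prop :=
  forall p, boundary Omega p -> exists rho, local_defining_function Omega p rho.

(* The normalized gradient does not depend on the choice of the local defining
   function, so that [get] selects its only possible value. *)
Definition outward_normal {R : realType} {n : nat} (Omega : set 'rV[R]_n)
    (p : 'rV[R]_n) : 'rV[R]_n :=
  get [set v | exists rho, local_defining_function Omega p rho /\
                 v = (enorm (grad rho p))^-1 *: grad rho p].

(* The product A x B in R^m x R^n, identified with R^(m + n) by [row_mx]. *)
Definition rV_prod {R : realType} {m n : nat} (A : set 'rV[R]_m)
    (B : set 'rV[R]_n) : set 'rV[R]_(m + n) :=
  [set row_mx x y | x in A & y in B].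

(* Main.v *)
Require Import Defs.
From HB Require Import structures.
From mathcomp Require Import all_boot all_order all_algebra.
From mathcomp Require Import all_classical all_reals all_analysis.
From mathcomp Require Import zify lra.
Import Order.TTheory GRing.Theory Num.Theory.
Import numFieldNormedType.Exports.
Set Implicit Arguments.
Unset Strict Implicit.
Unset Printing Implicit Defensive.
Local Open Scope classical_set_scope.
Local Open Scope ring_scope.

(** The proof is a linking argument in which the gradient flow is replaced by
    iterates of one explicit map.

    Choose reals [a < b] strictly between the supremum and the infimum of the
    hypothesis and let [K] be the product of the two closures, a compact set.
    Suppose that [F] has no critical point in the open product.  Then no point
    of [K] at level [a <= F] is critical: its first coordinate cannot lie on
    the boundary of [Omega1], where [F < a], and if its second coordinate lies
    on the boundary of [Omega2] the normal derivative is nonzero.  Consider the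
    truncated descent step

      G x = x - e * max(0, F x - a) * grad F x.

    For [e] small it maps [K] into itself.  Indeed it fixes the points at level
    at most [a]; the other ones have their first coordinate in a compact part
    of [Omega1]; and on the boundary of [Omega2] the vector [- grad F] points
    into [Omega2] because the normal derivative is positive.  Moreover [G]
    lowers [F] by a fixed amount wherever [F >= b].  All this is local and
    becomes uniform by compactness ([uniform_descent]).  Iterating [G] on the
    horizontal section [x1 |-> (x1, q)], with [q] in [Omega2], yields a
    continuous section [h] over the closure of [Omega1] that lies in [K], still
    projects to the identity over the boundary of [Omega1], and satisfies
    [F < b] everywhere ([descent_section]).

    The first component of [h], extended by the identity, is a continuous
    self-map of the whole space which is the identity outside a bounded set.
    Such a map is onto ([onto_of_id_outside_bounded], a form of Brouwer's
    theorem), so some point of the section lies over [xbar], where [F >= b]: a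
    contradiction.

    The surjectivity theorem rests on the combinatorial lemma [chessboard],
    which is Stokes' formula modulo 2 for the standard (Freudenthal)
    triangulation of a grid: the cup product of the coboundaries of [n]
    labellings, summed over the grid, depends only on the labels on the faces,
    and equals 1 when the [i]-th labelling separates the two faces orthogonal
    to direction [i]. *)

(** * A parity theorem for labelled grids *)

Section Chessboard.
Variable n : nat.
Implicit Types (v w : 'I_n -> nat) (d e i : 'I_n) (D : {set 'I_n}).
Implicit Types (f : ('I_n -> nat) -> 'F_2) (fs : seq (('I_n -> nat) -> 'F_2)).

Definition upd v d k : 'I_n -> nat := fun i => if i == d then k else v i.

Definition step v d := upd v d (v d).+1.

(** The simplices with first vertex [v] of the standard triangulation of the
    unit cube spanned by the directions of [D] correspond to the monotone paths
    whose steps are distinct directions of [D].  This is the sum, over the paths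
    with [size fs] steps, of the product of the increments of the successive
    functions of [fs] along the successive steps: the cup product of the
    coboundaries of these functions. *)
Fixpoint path_sum D fs v : 'F_2 :=
  if fs is f :: fs' then
    \sum_(d in D) (f (step v d) + f v) * path_sum (D :\ d) fs' (step v d)
  else 1.

Lemma addF2 (x : 'F_2) : x + x = 0.
Proof. by case: x => -[|[|]] // ?; apply/val_inj. Qed.

Lemma updC v d e j k : d != e -> upd (upd v d j) e k = upd (upd v e k) d j.
Proof.
move=> de; apply/funext => i; rewrite /upd.
by case: (eqVneq i e) => // ->; rewrite eq_sym (negbTE de).
Qed.

Lemma upd_upd v d j k : upd (upd v d j) d k = upd v d k.
Proof. by apply/funext => i; rewrite /upd; case: eqP. Qed.

Lemma updE v d k : upd v d k d = k.
Proof. by rewrite /upd eqxx. Qed.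

Lemma upd_neq v d k i : i != d -> upd v d k i = v i.
Proof. by rewrite /upd => /negbTE ->. Qed.

Lemma step_neq v d i : i != d -> step v d i = v i.
Proof. exact: upd_neq. Qed.

Lemma stepC v d e : d != e -> step (step v d) e = step (step v e) d.
Proof.
move=> de; rewrite /step upd_neq 1?eq_sym// updC// [in RHS]upd_neq//.
Qed.

(** Swapping two consecutive directions of a path keeps all but one of its
    vertices; the contributions that do not see this vertex cancel in pairs. *)
Lemma sum_sym2 D (G : 'I_n -> 'I_n -> 'F_2) :
  (forall d e, d != e -> G d e = G e d) ->
  \sum_(d in D) \sum_(e in D :\ d) G d e = 0.
Proof.
move=> Gsym.
have -> : \sum_(d in D) \sum_(e in D :\ d) G d e =
    \sum_(d in D) \sum_(e in D | (e < d)%N) G d e +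
    \sum_(d in D) \sum_(e in D | (d < e)%N) G d e.
  rewrite -big_split; apply: eq_bigr => d dD /=.
  rewrite (bigID (fun e => (e < d)%N)) /=; congr (_ + _); apply: eq_bigl => e;
    rewrite !inE -val_eqE /=; case: (e \in D); rewrite ?andbT ?andbF //; lia.
rewrite [X in _ + X](exchange_big_dep (mem D)) /=; last by move=> d e _ /andP[].
rewrite -[RHS](addF2 (\sum_(d in D) \sum_(e in D | (e < d)%N) G d e)).
congr (_ + _); apply: eq_bigr => d dD; apply: eq_big => e; first by rewrite dD.
by move=> /and3P[_ _ ed]; apply: Gsym; rewrite -val_eqE /= neq_ltn ed.
Qed.

(** A cup product of coboundaries is a cocycle.  When [fs] has one function
    fewer than [D] has directions, the left side sums over the facets of the
    simplices of the cube that avoid the first vertex, the right side over those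
    that avoid the last one; the facets that avoid an inner vertex cancel by
    [sum_sym2]. *)
Lemma path_sum_closed fs D v :
  \sum_(d in D) path_sum (D :\ d) fs (step v d) =
  \sum_(d in D) path_sum (D :\ d) fs v.
Proof.
elim: fs D v => [|f fs IH] D v //=.
(* For a fixed [d], the induction hypothesis at [step v d] says that [Q d e] and
   [Q1 d e] have the same sum over [e]. *)
pose Q d e := path_sum (D :\ d :\ e) fs (step (step v d) e).
pose Q1 d e := path_sum (D :\ d :\ e) fs (step v d).
have setC d e : D :\ d :\ e = D :\ e :\ d by rewrite !finset.setDDl finset.setUC.
transitivity (\sum_(d in D) \sum_(e in D :\ d) f (step v d) * Q1 d e).
  transitivity (\sum_(d in D) \sum_(e in D :\ d) (f (step (step v d) e) * Q d e)
      + \sum_(d in D) \sum_(e in D :\ d) f (step v d) * Q d e).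
    rewrite -big_split; apply: eq_bigr => d _; rewrite -big_split.
    by apply: eq_bigr => e _; rewrite mulrDl.
  rewrite sum_sym2 ?add0r => [|d e de]; last first.
    by rewrite /Q setC stepC.
  by apply: eq_bigr => d _; rewrite -!mulr_sumr IH.
transitivity (\sum_(d in D) \sum_(e in D :\ d) f (step v e) * Q1 e d
   + \sum_(d in D) \sum_(e in D :\ d) f v * Q1 e d).
  rewrite [X in _ + X](_ : _ = 0) ?addr0.
    rewrite (exchange_big_dep (mem D)) /=; last by move=> d e _ /finset.setD1P[].
    apply: eq_bigr => d dD; apply: eq_bigl => e.
    by rewrite !inE eq_sym dD andbT andbC.
  transitivity (f v * \sum_(d in D) \sum_(e in D :\ d) path_sum (D :\ d :\ e) fs v).
    rewrite mulr_sumr; apply: eq_bigr => d _; rewrite -mulr_sumr -IH.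
    by congr (_ * _); apply: eq_bigr => e _; rewrite /Q1 setC.
  by rewrite sum_sym2 ?mulr0// => d e _; rewrite setC.
rewrite -big_split; apply: eq_bigr => d _; rewrite -big_split.
by apply: eq_bigr => e _; rewrite /= mulrDl /Q1 setC.
Qed.

Lemma path_sum_const f fs D v e :
  f \in fs -> e \notin D -> (forall w, w e = v e -> f w = f v) ->
  path_sum D fs v = 0.
Proof.
elim: fs D v => // g fs IH D v /=; rewrite inE => /orP[/eqP->|ffs] eD fc.
  apply: big1 => d dD; rewrite fc ?addF2 ?mul0r// step_neq//.
  by apply: contraNneq eD => ->.
apply: big1 => d dD; have ed : e != d by apply: contraNneq eD => ->.
rewrite [path_sum _ _ _](IH) ?mulr0// => [|w].
  by rewrite inE negb_and eD orbT.
by rewrite step_neq// => /fc ->; rewrite [RHS]fc// step_neq.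
Qed.

Lemma path_sum_neq0 f fs D v : f \in fs -> path_sum D fs v != 0 ->
  exists u u', [/\ f u != f u', forall i, (v i <= u i <= v i + (i \in D))%N &
                   forall i, (v i <= u' i <= v i + (i \in D))%N].
Proof.
elim: fs D v => // g fs IH D v; rewrite inE => ffs /=.
move=> nz; have [d dD] : exists2 d, d \in D &
    (g (step v d) + g v) * path_sum (D :\ d) fs (step v d) != 0.
  apply/exists_inP; apply: contraNT nz; rewrite negb_exists_in => /forall_inP H.
  by apply/eqP/big1 => d /H; rewrite negbK => /eqP.
rewrite mulf_eq0 negb_or => /andP[gd pd].
have bnd (b : bool) i : (b <= (i \in D :\ d))%N || (i == d) && ~~ b ->
  (v i <= step v d i + b <= v i + (i \in D))%N.
  rewrite /step /upd !inE; case: eqVneq => [->|_] /=.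
    by rewrite dD; case: b; lia.
  by case: b; lia.
have [fg|fg] := eqVneq f g.
  rewrite {}fg in ffs *; exists (step v d), v; split.
  - by apply: contraNneq gd => ->; rewrite addF2.
  - by move=> i; have := bnd false i; rewrite addn0; apply.
  - by move=> i; rewrite leqnn leq_addr.
move: ffs; rewrite (negbTE fg) /= => ffs.
have [u [u' [fu lu lu']]] := IH _ _ ffs pd.
have trans w : (forall i, (step v d i <= w i <= step v d i + (i \in D :\ d))%N) ->
  forall i, (v i <= w i <= v i + (i \in D))%N.
  move=> H i; have := H i; have := bnd false i; have := bnd (i \in D :\ d) i.
  by rewrite leqnn => /(_ isT) + /(_ isT); lia.
by exists u, u'; split => //; apply: trans.
Qed.

Variable N : nat.

(** Sum of [f] over the points that agree with [v] outside [s] and have their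
    coordinates in [0, N) along [s]; the starting value of [v] along [s] is
    overwritten. *)
Fixpoint box (s : seq 'I_n) f v : 'F_2 :=
  if s is d :: s' then \sum_(k < N) box s' f (upd v d k) else f v.

Lemma eq_box s f g v : f =1 g -> box s f v = box s g v.
Proof. by move=> fg; congr (box _ _ _); apply/funext. Qed.

Lemma box0 s v : box s (fun=> 0) v = 0.
Proof. by elim: s v => //= d s IH v; apply: big1. Qed.

Lemma box_sum (J : Type) (r : seq J) (p : pred J) s (f : J -> _) v :
  box s (fun w => \sum_(j <- r | p j) f j w) v = \sum_(j <- r | p j) box s (f j) v.
Proof.
elim: s v => //= d s IH v; rewrite exchange_big.
by apply: eq_bigr => k _.
Qed.

Lemma box_upd s f v d k : d \notin s ->
  box s f (upd v d k) = box s (fun w => f (upd w d k)) v.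
Proof.
elim: s v => //= e s IH v; rewrite inE negb_or => /andP[de ds].
by apply: eq_bigr => j _; rewrite updC// IH.
Qed.

Lemma box_telescope s f v d : uniq s -> d \in s ->
  box s (fun w => f (step w d) + f w) v =
  box (rem d s) (fun w => f (upd w d N) + f (upd w d 0)) v.
Proof.
elim: s v => //= e s IH v /andP[es us]; rewrite inE.
case: (eqVneq d e) => [->|de] /= ds.
  under eq_bigr do rewrite box_upd//.
  rewrite -box_sum; apply: eq_box => w.
  elim: N => [|m IHm]; first by rewrite big_ord0 addF2.
  rewrite big_ord_recr /= IHm /step upd_upd updE addrC -addrA; congr (_ + _).
  by rewrite addrA addF2 add0r.
by apply: eq_bigr => k _; rewrite IH.
Qed.

(** Induction on the dimension.  Since [path_sum] is closed, the summand is the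
    coboundary of [fam d] times the lower-dimensional [path_sum], and the sum
    over the box telescopes to its faces.  On a face orthogonal to [e <> d] the
    product contains the increment of [fam e], which is constant there; on the
    face [w d = 0] the factor [fam d] vanishes; on the face [w d = N] it is 1
    and what remains is the sum in one dimension less. *)
Lemma chessboard_parity (fam : 'I_n -> ('I_n -> nat) -> 'F_2) s v :
  (forall i w, w i = 0%N -> fam i w = 0) -> (forall i w, w i = N -> fam i w = 1) ->
  uniq s -> box s (path_sum [set:: s] (map fam s)) v = 1.
Proof.
move=> fam0 famN; elim: s v => [|d s IH] v // us.
pose fs := map fam s; pose D := [set:: d :: s].
pose h e w := fam d w * path_sum (D :\ e) fs w.
have hE w : path_sum D (map fam (d :: s)) w =
    \sum_(e in D) (h e (step w e) + h e w).
  rewrite /= big_split /= /h -mulr_sumr -path_sum_closed mulr_sumr -big_split.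
  by apply: eq_bigr => e _; rewrite mulrDl.
rewrite (eq_box _ _ hE) box_sum (bigD1 d) ?inE ?eqxx//.
have := us; rewrite cons_uniq => /andP[ds us'].
rewrite -[RHS]addr0; congr (_ + _).
  rewrite (box_telescope (h d) v us) ?mem_head// /= eqxx.
  have hd w : h d (upd w d N) + h d (upd w d 0) =
      path_sum [set:: s] fs (upd w d N).
    rewrite /h famN ?updE// fam0 ?updE// mul0r addr0 mul1r.
    congr (path_sum _ _ _); apply/finset.setP => i; rewrite !inE.
    by case: eqVneq => //= ->; rewrite (negbTE ds).
  by rewrite (eq_box _ _ hd) -box_upd// IH.
apply: big1 => e /andP[]; rewrite inE => es ed.
rewrite (box_telescope (h e) v us es) -[RHS](box0 (rem e (d :: s)) v).
have {}es : e \in s by move: es; rewrite inE (negbTE ed).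
have face c w : c = 0%N \/ c = N -> h e (upd w e c) = 0.
  move=> c0N; rewrite /h (@path_sum_const (fam e) _ _ _ e) ?mulr0 ?map_f//.
    by rewrite !inE eqxx.
  move=> u; rewrite updE.
  by case: c0N => -> ue; [rewrite !fam0 ?updE | rewrite !famN ?updE].
by apply: eq_box => w; rewrite !face ?addr0; by [|right|left].
Qed.

Lemma box_neq0 s f v : uniq s -> box s f v != 0 ->
  exists w, [/\ f w != 0, forall i, i \in s -> (w i < N)%N &
                forall i, i \notin s -> w i = v i].
Proof.
elim: s v => [|d s IH] v /=; first by exists v.
move=> /andP[ds us] nz; have [k _] : exists2 k : 'I_N, k \in predT &
    box s f (upd v d k) != 0.
  apply/exists_inP; apply: contraNT nz; rewrite negb_exists_in => /forall_inP H.
  by apply/eqP/big1 => k _; apply/eqP/negPn/(H k).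
move=> /(IH _ us) [w [fw ws wNs]]; exists w; split=> // i.
  rewrite inE => /orP[/eqP->|/ws//]; rewrite wNs// updE; exact: ltn_ord.
by rewrite inE negb_or => /andP[id ins]; rewrite wNs// upd_neq.
Qed.

(** The parity sum is nonzero, hence so is the contribution of some cube [w];
    a path contributes only if every label changes along one of its edges. *)
Lemma chessboard (L : 'I_n -> ('I_n -> nat) -> bool) :
  (forall i w, w i = 0%N -> L i w = false) ->
  (forall i w, w i = N -> L i w = true) ->
  exists w : 'I_n -> nat, (forall i, (w i < N)%N) /\
    forall i, exists u u', [/\ L i u != L i u',
      forall j, (w j <= u j <= (w j).+1)%N & forall j, (w j <= u' j <= (w j).+1)%N].
Proof.
move=> L0 LN.
pose fam i w : 'F_2 := (L i w)%:R.
pose s := enum 'I_n.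
have box1 : box s (path_sum [set:: s] (map fam s)) (fun=> 0%N) = 1.
  apply: chessboard_parity; [| |exact: enum_uniq].
  - by move=> i w /L0; rewrite /fam => ->.
  - by move=> i w /LN; rewrite /fam => ->.
have /(box_neq0 (enum_uniq _)) [w [pw wN _]] :
    box s (path_sum [set:: s] (map fam s)) (fun=> 0%N) != 0.
  by rewrite box1 oner_eq0.
exists w; split=> [i|i]; first by apply: wN; rewrite mem_enum.
have fs_i : fam i \in map fam s by apply: map_f; rewrite mem_enum.
have [u [u' [fu lu lu']]] := path_sum_neq0 fs_i pw.
have {}s1 j : j \in [set:: s] by rewrite inE mem_enum.
exists u, u'; split=> [|j|j].
- by apply: contraNneq fu => Luu'; rewrite /fam Luu'.
- by have := lu j; rewrite s1 addn1.
- by have := lu' j; rewrite s1 addn1.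
Qed.

End Chessboard.

(** * Maps equal to the identity outside a bounded set are onto *)

Lemma cvg_rV (R : realType) (T : Type) (F : set_system T) (n : nat)
    (f : T -> 'rV[R]_n) (l : 'rV[R]_n) : Filter F ->
  (forall j, f t 0 j @[t --> F] --> l 0 j) -> f t @[t --> F] --> l.
Proof.
move=> FF fl A [P lP PA].
have : \forall t \near F, forall ij : 'I_1 * 'I_n, P ij.1 ij.2 (f t ij.1 ij.2).
  apply: filter_forall => -[i j] /=; rewrite (ord1 i).
  exact: fl (lP 0 j).
by apply: filterS => t ft; apply: PA => i j; exact: ft (i, j).
Qed.

Lemma cvg_row_mx (R : realType) (T : Type) (F : set_system T) (m n : nat)
    (u : T -> 'rV[R]_m) (v : T -> 'rV[R]_n) (l : 'rV[R]_m) (k : 'rV[R]_n) :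
  Filter F -> u t @[t --> F] --> l -> v t @[t --> F] --> k ->
  row_mx (u t) (v t) @[t --> F] --> row_mx l k.
Proof.
move=> FF ul vk; apply: cvg_rV => j; case: (split_ordP j) => i ->.
  under eq_cvg do rewrite row_mxEl; rewrite row_mxEl.
  exact: (cvg_comp _ _ ul (@coord_continuous _ _ _ 0 i l)).
under eq_cvg do rewrite row_mxEr; rewrite row_mxEr.
exact: (cvg_comp _ _ vk (@coord_continuous _ _ _ 0 i k)).
Qed.

Lemma coord_le_norm (R : realType) (n : nat) (x : 'rV[R]_n) i : `|x 0 i| <= `|x|.
Proof.
rewrite [leRHS]/Num.Def.normr /= mx_normrE.
exact: (le_bigmax _ (fun ij => `|x ij.1 ij.2|) (0, i)).
Qed.

Lemma norm_le_coord (R : realType) (n : nat) (x : 'rV[R]_n) e : 0 <= e ->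
  (forall i, `|x 0 i| <= e) -> `|x| <= e.
Proof.
move=> e0 xe; rewrite [leLHS]/Num.Def.normr /= mx_normrE.
by apply: bigmax_le => // -[i j] _ /=; rewrite (ord1 i).
Qed.

Lemma norm_bounded_compact (R : realType) (n : nat) (M : R) :
  compact [set x : 'rV[R]_n | `|x| <= M].
Proof.
apply: bounded_closed_compact.
  by exists M; split=> [|r Mr x /= xM]; [exact: num_real|exact: le_trans xM (ltW Mr)].
exact: closed_comp (fun x _ => @norm_continuous _ _ x) (@closed_le _ M).
Qed.

(** If [f] misses [y] then near every point some coordinate of [f - y] keeps
    its sign, which contradicts [chessboard] on a fine enough grid. *)
Lemma sign_locally_constant (R : realType) (n : nat) (f : 'rV[R]_n -> 'rV[R]_n)
    (y x : 'rV[R]_n) : {for x, continuous f} -> f x <> y ->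
  exists i b, \forall z \near x, (y 0 i <= f z 0 i) = b.
Proof.
move=> cf fxy; have [i fyi] : exists i, f x 0 i != y 0 i.
  apply/existsP; apply: contra_notT fxy; rewrite negb_exists => /forallP fy.
  by apply/rowP => i; apply/eqP; have := fy i; rewrite negbK.
have cfi : f z 0 i @[z --> x] --> f x 0 i.
  exact: (continuous_comp cf (@coord_continuous _ _ _ 0 i _)).
exists i; move: fyi; rewrite neq_lt => /orP[fy|yf]; [exists false|exists true].
  by near=> z; apply/negbTE; rewrite -ltNge; near: z; exact: cvgr_lt cfi _ fy.
by near=> z; apply: ltW; near: z; exact: cvgr_gt cfi _ yf.
Unshelve. all: by end_near. Qed.

(** On a large cube, label the grid points by the signs of the coordinates of
    [f - y]: as [f] is the identity on the faces, the labels there are those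
    required by [chessboard].  The resulting cell meets both signs of every
    coordinate, whereas if [f] missed [y] every small ball would avoid a sign
    change in one coordinate. *)
Theorem onto_of_id_outside_bounded (R : realType) (n : nat)
    (f : 'rV[R]_n -> 'rV[R]_n) (B : R) :
  continuous f -> (forall x, B <= `|x| -> f x = x) -> forall y, exists x, f x = y.
Proof.
move=> cf fid y; apply: contrapT => fNy.
(* The cube [-M, M]^n has [y] in its interior, and [f] is the identity on its
   faces. *)
pose M := Num.max B `|y| + 1.
have BM : B <= M by rewrite ler_wpDr// le_max lexx.
have yM i : `|y 0 i| < M.
  by rewrite (le_lt_trans (coord_le_norm y i))// ltr_pwDr// le_max lexx orbT.
have M0 : 0 < M by rewrite ltr_wpDl// le_max normr_ge0 orbT.
pose P (e : R) (x : 'rV[R]_n) := exists i b, forall z, `|x - z| < e ->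
  (y 0 i <= f z 0 i) = b.
have : \forall e \near 0^'+, [set x : 'rV[R]_n | `|x| <= M] `<=` P e.
  apply: (iffLR (compact_near_coveringP _) (@norm_bounded_compact R n M)).
  move=> x _; have [|i [b]] := @sign_locally_constant R n f y x (cf x).
    by move=> fxy; apply: fNy; exists x.
  move=> /nbhs_ballP[r /= r0 rb].
  near=> x' e.
  have er : e < r / 2 by near: e; apply: nbhs_right_lt; exact: divr_gt0.
  have xx' : `|x - x'| < r / 2.
    by near: x'; apply: cvgr_dist_lt; rewrite ?divr_gt0.
  exists i, b => z x'z; apply: rb.
  rewrite -ball_normE /= (splitr r) -(subrKA x') (le_lt_trans (ler_normD _ _))//.
  by rewrite ltrD// (lt_trans x'z).
move=> gP; have [e [e0 Pe]] : exists e : R, 0 < e /\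
    [set x : 'rV[R]_n | `|x| <= M] `<=` P e.
  near ((0 : R)^'+) => e; exists e; split; first by [].
  by near: e.
pose N := (Num.truncn (2 * M / e)).+1.
pose h := 2 * M / N%:R.
have h0 : 0 < h by rewrite divr_gt0// mulr_gt0.
have he : h < e.
  by rewrite ltr_pdivrMr// [e * _]mulrC -ltr_pdivrMr// truncnS_gt.
pose pt (w : 'I_n -> nat) : 'rV[R]_n := \row_i (- M + (w i)%:R * h).
have hN : N%:R * h = 2 * M by rewrite /h mulrC divfK// pnatr_eq0.
have [i w wi|i w wi|w [wN wL]] := @chessboard n N (fun i w => y 0 i <= f (pt w) 0 i).
- have pi : pt w 0 i = - M by rewrite mxE wi mul0r addr0.
  rewrite fid; last first.
    by rewrite (le_trans BM)// (le_trans _ (coord_le_norm _ i))// pi normrN ler_norm.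
  by rewrite pi; apply/negbTE; rewrite -ltNge; have := yM i; rewrite ltr_norml => /andP[].
- have pi : pt w 0 i = M by rewrite mxE wi hN mulr2n mulrDl mul1r addrA addNr add0r.
  rewrite fid; last first.
    by rewrite (le_trans BM)// (le_trans _ (coord_le_norm _ i))// pi ler_norm.
  by rewrite pi; have := yM i; rewrite ltr_norml => /andP[_ /ltW].
have ptM : `|pt w| <= M.
  apply: norm_le_coord (ltW M0) _ => i; rewrite mxE ler_norml.
  have : (w i)%:R * h <= 2 * M by rewrite -hN ler_pM2r// ler_nat ltnW.
  have : 0 <= (w i)%:R * h by rewrite mulr_ge0// ltW.
  by lra.
have [i [b Pi]] := Pe _ ptM.
have near_w (u : 'I_n -> nat) : (forall j, (w j <= u j <= (w j).+1)%N) ->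
    `|pt w - pt u| < e.
  move=> wu; apply: le_lt_trans he; apply: norm_le_coord (ltW h0) _ => j.
  rewrite !mxE; have /andP[] := wu j; rewrite -2!(ler_nat R) -natr1 => wj uj.
  by rewrite ler_norml; nra.
have [u [u' [uu' /near_w /Pi fu /near_w /Pi fu']]] := wL i.
by rewrite fu fu' eqxx in uu'.
Unshelve. all: by end_near. Qed.

(** * Decrease along a direction field *)

Lemma derive_dotp_grad (R : realType) (n : nat) (f : 'rV[R]_n -> R) x v :
  differentiable f x -> 'D_v f x = dotp (grad f x) v.
Proof.
move=> df; rewrite deriveE// [in LHS](row_sum_delta v) linear_sum /dotp.
by apply: eq_bigr => i _; rewrite linearZ /= -deriveE// mxE mulrC.
Qed.

Lemma is_derive_line (R : realType) (n : nat) (f : 'rV[R]_n -> R) x w (t : R) :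
  differentiable f (x + t *: w) ->
  is_derive t 1 (fun s => f (x + s *: w)) (dotp (grad f (x + t *: w)) w).
Proof.
move=> df; pose g (s : R) := x + s *: w.
have dg : is_diff t g (cst 0 + *:%R^~ w).
  have -> : g = cst x + *:%R^~ w by apply/funext.
  exact: is_diffD (is_diff_cst x t) (is_diff_scalel t w).
have dfg : differentiable (f \o g) t by apply: differentiable_comp.
apply: DeriveDef; first exact/derivable1_diffP.
rewrite (_ : (fun s => f (x + s *: w)) = f \o g)// deriveE// diff_comp//= diff_val.
rewrite -deriveE// derive_dotp_grad//; congr (dotp _ _).
by rewrite -[RHS]add0r -[in RHS](scale1r w).
Qed.

Lemma cvg_dotp (R : realType) (n : nat) (T : Type) (F : set_system T)
    (u v : T -> 'rV[R]_n) (l m : 'rV[R]_n) : Filter F ->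
  u t @[t --> F] --> l -> v t @[t --> F] --> m ->
  dotp (u t) (v t) @[t --> F] --> dotp l m.
Proof.
move=> FF ul vm; rewrite /dotp; apply: cvg_big => [|i _]; first exact: add_continuous.
apply: cvgM.
  exact: (cvg_comp _ _ ul (@coord_continuous _ _ _ 0 i l)).
exact: (cvg_comp _ _ vm (@coord_continuous _ _ _ 0 i m)).
Qed.

Lemma dotpZr (R : realType) (n : nat) (a : R) (u v : 'rV[R]_n) :
  dotp u (a *: v) = a * dotp u v.
Proof. by rewrite /dotp mulr_sumr; apply: eq_bigr => i _; rewrite mxE mulrCA. Qed.

(** Mean value theorem on the segment from [X t] to [X t - S t *: V t].  The
    formulation with moving base points, directions and steps along a filter
    is what turns the estimate into one that is uniform on a compact set. *)
Lemma uniform_decrease (R : realType) (n : nat) (f : 'rV[R]_n -> R)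
    (p v0 : 'rV[R]_n) (c : R) :
  (\forall x \near p, differentiable f x) -> {for p, continuous (grad f)} ->
  c < dotp (grad f p) v0 ->
  forall (T : Type) (F : set_system T) (X V : T -> 'rV[R]_n) (S : T -> R),
    Filter F -> X t @[t --> F] --> p -> V t @[t --> F] --> v0 ->
    S t @[t --> F] --> 0 ->
  \forall t \near F, 0 <= S t -> f (X t - S t *: V t) <= f (X t) - S t * c.
Proof.
move=> df cg cp T F X V S FF Xp Vv S0.
have dcvg : dotp (grad f z.1) z.2 @[z --> (p, v0)] --> dotp (grad f p) v0.
  apply: cvg_dotp; last exact: (@cvg_snd _ _ (nbhs p)).
  apply: (@cvg_comp _ _ _ fst (grad f) _ (nbhs p)); last exact: cg.
  exact: (@cvg_fst _ _ _ (nbhs v0)).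
have : \forall z \near (p, v0), c < dotp (grad f z.1) z.2.
  exact: cvgr_gt dcvg _ cp.
case=> -[A B] /= [Ap Bv AB].
have /nbhs_ballP[r /= r0 rA] : nbhs p (A `&` [set x | differentiable f x]).
  exact: filterI.
have SV0 : S t *: V t @[t --> F] --> (0 : 'rV[R]_n).
  by rewrite -(scale0r v0); apply: cvgZ.
near=> t => St.
have Xt : `|p - X t| < r / 2.
  by near: t; apply: cvgr_dist_lt Xp _ _; rewrite divr_gt0.
have SVt : `|S t *: V t| < r / 2.
  rewrite -normrN -sub0r; near: t.
  by apply: cvgr_dist_lt SV0 _ _; rewrite divr_gt0.
have BVt : B (V t) by near: t; exact: Vv.
pose w := - (S t *: V t).
have inA (s : R) : 0 <= s <= 1 -> ball p r (X t + s *: w).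
  move=> /andP[s0 s1]; rewrite -ball_normE /= opprD addrA (splitr r).
  rewrite (le_lt_trans (ler_normB _ _))// ltrD// normrZ normrN.
  by rewrite (le_lt_trans _ SVt)// ger0_norm// ler_piMl.
have dl (s : R) : 0 <= s <= 1 ->
    is_derive s 1 (fun s => f (X t + s *: w)) (dotp (grad f (X t + s *: w)) w).
  by move=> /inA/rA[_ ?]; exact: is_derive_line.
have [||s] := @MVT_segment R (fun s => f (X t + s *: w))
  (fun s => dotp (grad f (X t + s *: w)) w) 0 1 ler01.
- by move=> s; rewrite in_itv /= => /andP[/ltW s0 /ltW s1]; apply: dl; rewrite s0.
- apply: derivable_within_continuous => s; rewrite in_itv /= => /dl ?.
  exact: ex_derive.
rewrite in_itv /= => s01; rewrite scale1r scale0r addr0 subr0 mulr1 => fE.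
have := AB (X t + s *: w, V t) (conj (rA _ (inA _ s01)).1 BVt) => /= /ltW cV.
have -> : f (X t - S t *: V t) = f (X t) + dotp (grad f (X t + s *: w)) w.
  by rewrite -fE [RHS]addrC subrK.
have -> u : dotp u w = - (S t * dotp u (V t)) by rewrite /w -scaleNr dotpZr mulNr.
by rewrite lerD2l lerN2 ler_wpM2l.
Unshelve. all: by end_near. Qed.

Lemma is_CkS (R : realType) (n k : nat) (U : set 'rV[R]_n) (f : 'rV[R]_n -> R) :
  is_Ck k.+1 U f -> is_Ck k U f.
Proof.
elim: k f => [|k IH] f [df Cf]; first by move=> x /df /differentiable_continuous.
by split=> // i; apply: IH; exact: Cf.
Qed.

Lemma grad_continuous (R : realType) (n : nat) (U : set 'rV[R]_n)
    (f : 'rV[R]_n -> R) x : is_Ck 1 U f -> U x -> {for x, continuous (grad f)}.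
Proof.
move=> [_ Cf] Ux; apply: (@cvg_rV _ _ (nbhs x)) => j; rewrite mxE.
by under eq_cvg do rewrite mxE; exact: Cf.
Qed.

Lemma dotp_row0mx (R : realType) (m n : nat) (u : 'rV[R]_(m + n)) (w : 'rV[R]_n) :
  dotp u (row_mx 0 w) = dotp (rsubmx u) w.
Proof.
rewrite /dotp big_split_ord big1 /= ?add0r => [|i _].
  by apply: eq_bigr => i _; rewrite row_mxEr mxE.
by rewrite row_mxEl mxE mulr0.
Qed.

Lemma dotpp_gt0 (R : realType) (n : nat) (u : 'rV[R]_n) : u != 0 -> 0 < dotp u u.
Proof.
move=> u0; rewrite lt_neqAle eq_sym sumr_ge0 ?andbT => [|i _]; last first.
  by rewrite -expr2 sqr_ge0.
apply: contra u0; rewrite psumr_eq0 => [/allP u0|i _]; last first.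
  by rewrite -expr2 sqr_ge0.
apply/eqP/rowP => i; rewrite mxE.
by have := u0 i (mem_index_enum _); rewrite mulf_eq0 orbb => /eqP.
Qed.

Lemma closure_image_closed (T V : topologicalType) (A : set T) (C : set V)
    (g : T -> V) y :
  closed C -> (forall z, A z -> C (g z)) -> closure A y -> {for y, continuous g} ->
  C (g y).
Proof.
move=> Ccl gC Ay gy; apply: Ccl => B /gy gB.
by have [z [Az Bz]] := Ay _ gB; exists (g z); split; [exact: gC|].
Qed.

Lemma lte_real_between (R : realType) (x y : \bar R) :
  (x < y)%E -> exists r : R, (x < r%:E)%E /\ (r%:E < y)%E.
Proof.
case: x y => [x||] [y||] //.
- rewrite lte_fin => xy; exists ((x + y) / 2).
  by rewrite !lte_fin; split; lra.
- by move=> _; exists (x + 1); rewrite lte_fin ltry; split => //; lra.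
- by move=> _; exists (y - 1); rewrite lte_fin ltNyr; split => //; lra.
- by move=> _; exists 0; rewrite ltNyr ltry.
Qed.

(** Close to [p] the closure of [Omega] is contained in [rho <= 0], and [rho < 0]
    implies membership in [Omega]; a positive step makes [rho] decrease
    strictly, so it ends in [Omega] itself. *)
Lemma step_in_closure (R : realType) (n : nat) (Omega : set 'rV[R]_n)
    (p v0 : 'rV[R]_n) (rho : 'rV[R]_n -> R) :
  local_defining_function Omega p rho -> 0 < dotp (grad rho p) v0 ->
  forall (T : Type) (F : set_system T) (X V : T -> 'rV[R]_n) (S : T -> R),
    Filter F -> X t @[t --> F] --> p -> V t @[t --> F] --> v0 ->
    S t @[t --> F] --> 0 ->
  \forall t \near F, 0 <= S t -> closure Omega (X t) ->
    closure Omega (X t - S t *: V t).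
Proof.
move=> [U [oU Up Crho _ OmegaU]] rv T F X V S FF Xp Vv S0.
have rho_le0 x : U x -> closure Omega x -> rho x <= 0.
  move=> Ux clx; rewrite leNgt; apply/negP => rx.
  have crho : rho z @[z --> x] --> rho x by exact: (Crho 0%N).
  have : nbhs x (U `&` [set z | 0 < rho z]).
    by apply: filterI; [exact: open_nbhs_nbhs|exact: cvgr_gt crho _ rx].
  move=> /clx[z [Oz [Uz rz]]].
  have : (Omega `&` U) z by [].
  by rewrite OmegaU => -[/= rz0 _]; have := lt_trans rz rz0; rewrite ltxx.
have SV0 : X t - S t *: V t @[t --> F] --> p.
  by rewrite -[X in _ --> X]subr0 -(scale0r v0); apply: cvgB => //; apply: cvgZ.
have nU : nbhs p U by exact: open_nbhs_nbhs.
have dl := @uniform_decrease R n rho p v0 (dotp (grad rho p) v0 / 2).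
have {dl} : \forall t \near F, 0 <= S t ->
    rho (X t - S t *: V t) <= rho (X t) - S t * (dotp (grad rho p) v0 / 2).
  apply: dl => //; last by lra.
  - by apply: filterS nU => x; exact: (Crho 1%N).1.
  - exact: grad_continuous (Crho 1%N) Up.
move=> dec; near=> t => St clX.
have [->|S_neq0] := eqVneq (S t) 0; first by rewrite scale0r subr0.
have UX : U (X t) by near: t; exact: Xp.
have UG : U (X t - S t *: V t) by near: t; exact: SV0.
apply: subset_closure; suff : (Omega `&` U) (X t - S t *: V t) by case.
rewrite OmegaU; split => //=.
have : rho (X t - S t *: V t) <= rho (X t) - S t * (dotp (grad rho p) v0 / 2).
  by move: St; near: t.
move=> /le_lt_trans; apply; rewrite subr_lt0 (le_lt_trans (rho_le0 _ UX clX))//.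
by rewrite mulr_gt0 ?divr_gt0// lt_neqAle eq_sym S_neq0.
Unshelve. all: by end_near. Qed.

(** The product of the closures, described by the two projections so that
    membership needs no decomposition of the vector. *)
Definition closure_prod (R : realType) (m n : nat) (A : set 'rV[R]_m)
    (B : set 'rV[R]_n) : set 'rV[R]_(m + n) :=
  [set x | closure A (lsubmx x) /\ closure B (rsubmx x)].

Lemma closure_prod_sub (R : realType) (m n : nat) (A : set 'rV[R]_m)
    (B : set 'rV[R]_n) : closure_prod A B `<=` closure (rV_prod A B).
Proof.
move=> x [Ax Bx] C /nbhs_ballP[r /= r0 rC].
have [y [Ay [_ xy]]] := Ax _ (nbhsx_ballx _ _ r0).
have [z [Bz [_ xz]]] := Bx _ (nbhsx_ballx _ _ r0).
exists (row_mx y z); split; first by exists y => //; exists z.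
apply: rC; split=> // i j; rewrite (ord1 i); case: (split_ordP j) => k ->.
  by rewrite row_mxEl; have := xy 0 k; rewrite mxE.
by rewrite row_mxEr; have := xz 0 k; rewrite mxE.
Qed.

Lemma bounded_closure (R : realType) (n : nat) (A : set 'rV[R]_n) :
  bounded_set A -> exists M, forall x, closure A x -> `|x| <= M.
Proof.
move=> [M [_ AM]]; exists (M + 1) => x clx.
have AM1 z : A z -> [set r | r <= M + 1] `|z|.
  by move=> Az; apply: AM => //; rewrite ltrDl.
exact: (closure_image_closed (@closed_le _ (M + 1)) AM1 clx (@norm_continuous _ _ x)).
Qed.

Lemma closure_prod_compact (R : realType) (m n : nat) (A : set 'rV[R]_m)
    (B : set 'rV[R]_n) : bounded_set A -> bounded_set B ->
  compact (closure_prod A B).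
Proof.
move=> /bounded_closure[M AM] /bounded_closure[N BN].
apply: (subclosed_compact _ (@norm_bounded_compact R (m + n) (Num.max 0 (Num.max M N)))).
  apply: closedI.
    apply: (@closed_comp _ _ lsubmx (closure A)); last exact: closed_closure.
    by move=> x _; exact: continuous_lsubmx.
  apply: (@closed_comp _ _ rsubmx (closure B)); last exact: closed_closure.
  by move=> x _; exact: continuous_rsubmx.
move=> x [/AM xM /BN xN]; apply: norm_le_coord; first by rewrite le_max lexx.
move=> j; case: (split_ordP j) => k ->; rewrite !le_max.
  have := le_trans (coord_le_norm _ k) xM; rewrite mxE => ->.
  by rewrite orbT.
have := le_trans (coord_le_norm _ k) xN; rewrite mxE => ->.
by rewrite !orbT.
Qed.

(** * Truncated gradient descent *)

(** The truncation by [F x - a] makes the step vanish continuously at level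
    [a], so that points at lower levels do not move. *)
Definition descent (R : realType) (n : nat) (F : 'rV[R]_n -> R) (a e : R)
    (x : 'rV[R]_n) : 'rV[R]_n := x - (e * Num.max 0 (F x - a)) *: grad F x.

Lemma cutoff_continuous (R : realType) (T : topologicalType) (F : T -> R) (a : R) x :
  {for x, continuous F} -> {for x, continuous (fun y => Num.max 0 (F y - a))}.
Proof.
move=> cF; apply: (@continuous_max _ _ (cst 0) (fun y => F y - a)).
  exact: cvg_cst.
by apply: cvgB => //; exact: cvg_cst.
Qed.

Lemma descent_below (R : realType) (n : nat) (F : 'rV[R]_n -> R) a e x :
  F x <= a -> descent F a e x = x.
Proof.
by move=> Fxa; rewrite /descent max_l ?subr_le0// mulr0 scale0r subr0.
Qed.

(** Step size [e] and decrease rate [c] are both found as small positive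
    numbers near each point of the compact set, then made uniform by the
    covering property of compact sets.  Near a point below level [a] the step is
    trivial.  At a point [p] with [F p >= a], the first coordinate is interior
    to [A] and stays there; the second one stays in the closure of [B] by
    [step_in_closure]; and [F] decreases at rate almost [|grad F p|^2 > 0]. *)
Lemma uniform_descent (R : realType) (m n : nat) (A : set 'rV[R]_m)
    (B : set 'rV[R]_n) (F : 'rV[R]_(m + n) -> R) (U : set 'rV[R]_(m + n)) (a : R) :
  open A -> open B -> open U -> compact (closure_prod A B) ->
  closure_prod A B `<=` U -> is_Ck 1 U F ->
  (forall x, closure_prod A B x -> boundary A (lsubmx x) -> F x < a) ->
  (forall x, closure_prod A B x -> a <= F x -> grad F x != 0) ->
  (forall x, A (lsubmx x) -> boundary B (rsubmx x) -> exists2 rho,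
     local_defining_function B (rsubmx x) rho &
     0 < dotp (grad rho (rsubmx x)) (rsubmx (grad F x))) ->
  exists e c, [/\ 0 < e, 0 < c & forall x, closure_prod A B x ->
    closure_prod A B (descent F a e x) /\
    F (descent F a e x) <= F x - e * Num.max 0 (F x - a) * c].
Proof.
move=> oA oB oU cK KU F1 Fbd Fcrit Fin.
pose K := closure_prod A B.
pose P (ec : R * R) x := K x -> K (descent F a ec.1 x) /\
    F (descent F a ec.1 x) <= F x - ec.1 * Num.max 0 (F x - a) * ec.2.
suff : \forall ec \near filter_prod (0 : R)^'+ (0 : R)^'+, K `<=` P ec.
  move=> KP; have e0 : \forall ec \near filter_prod (0 : R)^'+ (0 : R)^'+, 0 < ec.1.
    exact: (@cvg_fst _ _ _ _ _ [set e | 0 < e] (nbhs_right_gt (0 : R))).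
  have c0 : \forall ec \near filter_prod (0 : R)^'+ (0 : R)^'+, 0 < ec.2.
    exact: (@cvg_snd _ _ _ _ _ [set e | 0 < e] (nbhs_right_gt (0 : R))).
  have [[e c] [KPe [e_gt0 c_gt0]]] := filter_ex (filterI KP (filterI e0 c0)).
  by exists e, c; split=> // x Kx; exact: (KPe x Kx Kx).
apply: (iffLR (compact_near_coveringP _) cK) => p Kp.
have Up : U p by exact: KU.
have cF : {for p, continuous F} by exact: (is_CkS F1).
have cg : {for p, continuous (grad F)} by exact: grad_continuous F1 Up.
pose FF := filter_prod (nbhs p) (filter_prod (0 : R)^'+ (0 : R)^'+).
have FX : z.1 @[z --> FF] --> p by exact: (@cvg_fst _ _ (nbhs p)).
have Fe : z.2.1 @[z --> FF] --> (0 : R)^'+.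
  apply: (@cvg_comp _ _ _ snd fst _ (filter_prod (0 : R)^'+ (0 : R)^'+)).
    exact: cvg_snd.
  exact: cvg_fst.
have Fc : z.2.2 @[z --> FF] --> (0 : R)^'+.
  apply: (@cvg_comp _ _ _ snd snd _ (filter_prod (0 : R)^'+ (0 : R)^'+)).
    exact: cvg_snd.
  exact: cvg_snd.
have [Fpa|aFp] := ltP (F p) a.
  have Fz : F z.1 @[z --> FF] --> F p by exact: (cvg_comp _ _ FX cF).
  have Fza : \forall z \near FF, F z.1 < a by exact: cvgr_lt Fz _ Fpa.
  apply: filterS Fza => z /ltW Fza Kz; rewrite descent_below//.
  by rewrite max_l ?subr_le0// mulr0 mul0r subr0.
have [clAp clBp] := Kp.
have Ap : A (lsubmx p).
  apply: contrapT => nAp; have : F p < a.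
    by apply: Fbd => //; split=> //; rewrite (interior_id A).1.
  by rewrite ltNge aFp.
pose mu := dotp (grad F p) (grad F p).
have mu0 : 0 < mu by apply/dotpp_gt0/Fcrit.
have FV : grad F z.1 @[z --> FF] --> grad F p by exact: (cvg_comp _ _ FX cg).
pose S (z : 'rV[R]_(m + n) * (R * R)) := z.2.1 * Num.max 0 (F z.1 - a).
have FS : S z @[z --> FF] --> (0 : R).
  rewrite -(mul0r (Num.max 0 (F p - a))); apply: cvgM.
    by apply: cvg_trans Fe _; exact: cvg_within.
  have cM : {for p, continuous (fun x => Num.max 0 (F x - a))}.
    exact: cutoff_continuous.
  exact: (cvg_comp _ _ FX cM).
have S_ge0 : \forall z \near FF, 0 <= S z.
  have : \forall z \near FF, 0 < z.2.1.
    exact: (Fe [set e | 0 < e] (nbhs_right_gt (0 : R))).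
  by apply: filterS => z z0; rewrite mulr_ge0 ?(ltW z0)// le_max lexx.
have FG : descent F a z.2.1 z.1 @[z --> FF] --> p.
  by rewrite -[X in _ --> X]subr0 -(scale0r (grad F p)); apply: cvgB => //; apply: cvgZ.
have inA : \forall z \near FF, A (lsubmx (descent F a z.2.1 z.1)).
  have := cvg_comp _ _ FG (@continuous_lsubmx _ _ _ _ p).
  by move=> /(_ A); apply; exact: open_nbhs_nbhs.
have inB : \forall z \near FF, closure B (rsubmx z.1) ->
    closure B (rsubmx (descent F a z.2.1 z.1)).
  have [Bp|nBp] := pselect (B (rsubmx p)).
    have := cvg_comp _ _ FG (@continuous_rsubmx _ _ _ _ p).
    move=> /(_ B) near_B.
    have : \forall z \near FF, B (rsubmx (descent F a z.2.1 z.1)).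
      by apply: near_B; exact: open_nbhs_nbhs.
    by apply: filterS => z /subset_closure.
  have [|rho rho_def rhoF] := Fin p Ap.
    by split=> //; rewrite (interior_id B).1.
  have stepB : \forall z \near FF, 0 <= S z -> closure B (rsubmx z.1) ->
      closure B (rsubmx z.1 - S z *: rsubmx (grad F z.1)).
    apply: (step_in_closure rho_def rhoF) => //.
    - exact: (cvg_comp _ _ FX (@continuous_rsubmx _ _ _ _ p)).
    - exact: (cvg_comp _ _ FV (@continuous_rsubmx _ _ _ _ (grad F p))).
  apply: filterS2 S_ge0 stepB => z S0 stepz clBz.
  by rewrite /descent linearB linearZ; exact: stepz.
have dF : \forall z \near FF, 0 <= S z ->
    F (descent F a z.2.1 z.1) <= F z.1 - S z * (mu / 2).
  apply: (uniform_decrease (p := p) (v0 := grad F p)) => //.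
  - by apply: filterS (open_nbhs_nbhs (conj oU Up)) => x; exact: F1.1.
  - by rewrite -/mu; lra.
have cmu : \forall z \near FF, z.2.2 < mu / 2.
  by apply: (Fc [set c | c < mu / 2]); apply: nbhs_right_lt; rewrite divr_gt0.
near=> z => -[clA clB]; split.
  split; first by apply: subset_closure; near: z.
  by move: clB; near: z.
have Sz : 0 <= S z by near: z.
have cz : z.2.2 <= mu / 2 by apply: ltW; near: z.
have : F (descent F a z.2.1 z.1) <= F z.1 - S z * (mu / 2) by move: Sz; near: z.
by move=> /le_trans; apply; rewrite lerD2l lerN2 ler_wpM2l.
Unshelve. all: by end_near. Qed.

Lemma descent_continuous (R : realType) (n : nat) (U : set 'rV[R]_n)
    (F : 'rV[R]_n -> R) a e y :
  is_Ck 1 U F -> U y -> {for y, continuous (descent F a e)}.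
Proof.
move=> F1 Uy; have cM : {for y, continuous (fun x => Num.max 0 (F x - a))}.
  by apply: cutoff_continuous; exact: (is_CkS F1).
suff : x - (e * Num.max 0 (F x - a)) *: grad F x @[x --> y] --> descent F a e y.
  by [].
apply: (@cvgB _ _ _ (nbhs y)); first by move=> ? ?.
apply: (@cvgZ _ _ _ (nbhs y)); last exact: grad_continuous F1 Uy.
by apply: (@cvgM _ _ (nbhs y)); [exact: cvg_cst|exact: cM].
Qed.

Lemma bounded_above_compact (R : realType) (T : topologicalType) (K : set T)
    (F : T -> R) : compact K -> (forall x, K x -> {for x, continuous F}) ->
  exists M, forall x, K x -> F x <= M.
Proof.
move=> cK cF; have : \forall M \near +oo, K `<=` [set x | F x <= M].
  apply: (iffLR (compact_near_coveringP _) cK) => p Kp.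
  have Fp1 : \forall x \near p, F x < F p + 1.
    have lt1 : F p < F p + 1 by rewrite ltrDl.
    exact: cvgr_lt (cF p Kp) _ lt1.
  near=> x M.
  have FpM : F p + 1 <= M by near: M; apply: nbhs_pinfty_ge; rewrite num_real.
  have Fx : F x < F p + 1 by near: x.
  exact: le_trans (ltW Fx) FpM.
by move=> /filter_ex[M KM]; exists M.
Unshelve. all: by end_near. Qed.

(** The sections are the iterates of [descent] on [x |-> (x, q)].  Over the
    boundary of [A] they do not move because [F < a] there.  As long as
    [F >= b], one step lowers [F] by at least [e * (b - a) * c]; once [F < b],
    this persists. *)
Lemma descent_section (R : realType) (m n : nat) (A : set 'rV[R]_m)
    (B : set 'rV[R]_n) (F : 'rV[R]_(m + n) -> R) (U : set 'rV[R]_(m + n))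
    (a b e c : R) :
  B !=set0 -> compact (closure_prod A B) -> closure_prod A B `<=` U ->
  is_Ck 1 U F -> a < b -> 0 < e -> 0 < c ->
  (forall x, closure_prod A B x -> boundary A (lsubmx x) -> F x < a) ->
  (forall x, closure_prod A B x ->
    closure_prod A B (descent F a e x) /\
    F (descent F a e x) <= F x - e * Num.max 0 (F x - a) * c) ->
  exists h : 'rV[R]_m -> 'rV[R]_(m + n),
    [/\ {within closure A, continuous h},
        forall x, closure A x -> closure_prod A B (h x),
        forall x, boundary A x -> lsubmx (h x) = x &
        forall x, closure A x -> F (h x) < b].
Proof.
move=> [q Bq] cK KU F1 ab e0 c0 Fbd step.
have cF x : closure_prod A B x -> {for x, continuous F}.
  by move=> /KU; exact: (is_CkS F1).
have [M KM] := bounded_above_compact cK cF.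
pose eta := e * (b - a) * c.
have eta0 : 0 < eta by rewrite !mulr_gt0// subr_gt0.
have sections k : exists h : 'rV[R]_m -> 'rV[R]_(m + n),
    [/\ {within closure A, continuous h},
        forall x, closure A x -> closure_prod A B (h x),
        forall x, boundary A x -> lsubmx (h x) = x &
        forall x, closure A x -> F (h x) < b \/ F (h x) <= M - k%:R * eta].
  elim: k => [|k [h [ch hK hbd hF]]].
    have K0 x : closure A x -> closure_prod A B (row_mx x q).
      by move=> Ax; rewrite /closure_prod /= row_mxKl row_mxKr; split=> //;
        exact: subset_closure.
    exists (fun x => row_mx x q); split => //.
    - apply: continuous_subspaceT => x.
      by apply: (@cvg_row_mx _ _ (nbhs x)); [move=> ? ?|exact: cvg_cst].
    - by move=> x _; rewrite row_mxKl.
    - by move=> x Ax; right; rewrite mul0r subr0; exact/KM/K0.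
  exists (descent F a e \o h); split.
  - apply: within_continuous_comp ch => y; rewrite inE => -[x Ax <-].
    by apply: descent_continuous F1 _; exact/KU/hK.
  - by move=> x /hK/step[].
  - move=> x bx /=; rewrite descent_below ?hbd//; apply: ltW; apply: Fbd.
      by apply: hK; case: bx.
    by rewrite hbd.
  move=> x Ax /=; have [_ Fd] := step _ (hK x Ax).
  have [Fb|bF] := ltP (F (h x)) b.
    left; apply: le_lt_trans Fb; apply: (le_trans Fd).
    by rewrite lerBlDr lerDl !mulr_ge0 ?(ltW e0) ?(ltW c0)// le_max lexx.
  right; case: (hF x Ax); first by rewrite ltNge bF.
  move=> Fk; apply: (le_trans Fd); rewrite -natr1 mulrDl mul1r opprD addrA.
  by rewrite lerB// /eta ler_pM2r// ler_pM2l// le_max lerB ?orbT.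
have [h [ch hK hbd hF]] := sections (Num.truncn ((M - b) / eta)).+1.
exists h; split=> // x Ax; case: (hF x Ax) => // /le_lt_trans; apply.
by rewrite ltrBlDr -ltrBlDl -ltr_pdivrMr// truncnS_gt.
Qed.

Theorem lemmaA1 (R : realType) (n1 n2 : nat)
    (n1_ge1 : (1 <= n1)%N) (n2_ge1 : (1 <= n2)%N)
    (Omega1 : set 'rV[R]_n1) (Omega2 : set 'rV[R]_n2)
    (Omega1_bounded : bounded_set Omega1) (Omega1_open : open Omega1)
    (Omega2_bounded : bounded_set Omega2) (Omega2_open : open Omega2)
    (Omega2_nonempty : Omega2 !=set0) (Omega2_smooth : smooth_boundary Omega2)
    (F : 'rV[R]_(n1 + n2) -> R) (U : set 'rV[R]_(n1 + n2))
    (U_open : open U) (closure_sub_U : closure (rV_prod Omega1 Omega2) `<=` U)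
    (F_C2 : is_Ck 2 U F)
    (normal_derivative_gt0 : forall (x1 : 'rV[R]_n1) (x2 : 'rV[R]_n2),
      Omega1 x1 -> boundary Omega2 x2 ->
      0 < dotp (grad F (row_mx x1 x2)) (row_mx 0 (outward_normal Omega2 x2)))
    (inf_gt_sup : exists2 xbar : 'rV[R]_n1, Omega1 xbar &
      (ereal_sup [set (F x)%:E | x in rV_prod (boundary Omega1) Omega2] <
       ereal_inf [set (F (row_mx xbar x2))%:E | x2 in Omega2])%E) :
  exists2 x : 'rV[R]_(n1 + n2), rV_prod Omega1 Omega2 x & grad F x = 0.
Proof.
apply: contrapT => no_crit.
have [xbar Oxbar] := inf_gt_sup.
move=> /lte_real_between[a' [sup_a' /lte_real_between[a [a'a /lte_real_between[b [ab b_inf]]]]]].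
rewrite !lte_fin in a'a ab.
pose K := closure_prod Omega1 Omega2.
have KU : K `<=` U by move=> x /closure_prod_sub; exact: closure_sub_U.
have cK : compact K by exact: closure_prod_compact.
have F1 : is_Ck 1 U F by exact: is_CkS.
have crow x1 x2 : U (row_mx x1 x2) ->
    {for x2, continuous (fun y => F (row_mx x1 y))}.
  move=> Ux; apply: continuous_comp; last exact: (is_CkS F1).
  by apply: (@cvg_row_mx _ _ (nbhs x2)); [exact: cvg_cst|move=> ? ?].
have Fbd x : K x -> boundary Omega1 (lsubmx x) -> F x < a.
  move=> Kx bx; apply: le_lt_trans a'a; rewrite -(hsubmxK x).
  (* The supremum only sees [Omega2]; continuity extends the bound to its
     closure, and [a' < a] keeps the inequality strict. *)
  have Fa' y : Omega2 y -> [set r | r <= a'] (F (row_mx (lsubmx x) y)).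
    move=> Oy; rewrite /= -lee_fin; apply: le_trans (ltW sup_a').
    by apply: ereal_sup_ubound; exists (row_mx (lsubmx x) y) => //;
      exists (lsubmx x) => //; exists y.
  have cx : {for rsubmx x, continuous (fun y => F (row_mx (lsubmx x) y))}.
    by apply: crow; rewrite hsubmxK; exact: KU.
  exact: (closure_image_closed (@closed_le _ a') Fa' Kx.2 cx).
have Fb y : closure Omega2 y -> b <= F (row_mx xbar y).
  move=> cly.
  have Fb' z : Omega2 z -> [set r | b <= r] (F (row_mx xbar z)).
    move=> Oz; rewrite /= -lee_fin; apply: (le_trans (ltW b_inf)).
    by apply: ereal_inf_lbound; exists z.
  have cy : {for y, continuous (fun z => F (row_mx xbar z))}.
    apply: crow; apply: KU; split; rewrite ?row_mxKl ?row_mxKr//.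
    exact: subset_closure.
  exact: (closure_image_closed (@closed_ge _ b) Fb' cly cy).
have O1 x : closure Omega1 x -> ~ boundary Omega1 x -> Omega1 x.
  move=> clx nbx; apply: contrapT => nOx; apply: nbx; split => //.
  by rewrite (interior_id Omega1).1.
have Fin x : Omega1 (lsubmx x) -> boundary Omega2 (rsubmx x) -> exists2 rho,
     local_defining_function Omega2 (rsubmx x) rho &
     0 < dotp (grad rho (rsubmx x)) (rsubmx (grad F x)).
  move=> Ox bx; have := normal_derivative_gt0 _ _ Ox bx.
  rewrite hsubmxK dotp_row0mx.
  (* The normal selected by [get] is the normalized gradient of some local
     defining function; the argument goes on with that function. *)
  have [rho [rho_def ->]] : exists rho,
      local_defining_function Omega2 (rsubmx x) rho /\
      outward_normal Omega2 (rsubmx x) =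
      (enorm (grad rho (rsubmx x)))^-1 *: grad rho (rsubmx x).
    apply: (@getPex _ [set v | exists rho,
      local_defining_function Omega2 (rsubmx x) rho /\
      v = (enorm (grad rho (rsubmx x)))^-1 *: grad rho (rsubmx x)]).
    have [rho rho_def] := Omega2_smooth _ bx.
    by eexists; exists rho; split; [exact: rho_def|].
  rewrite dotpZr => pos; exists rho => //.
  have dotpC (u v : 'rV[R]_n2) : dotp u v = dotp v u.
    by apply: eq_bigr => i _; rewrite mulrC.
  rewrite dotpC ltNge; apply: contraTN pos => le0; rewrite -leNgt.
  by rewrite mulr_ge0_le0// invr_ge0 sqrtr_ge0.
have Fcrit x : K x -> a <= F x -> grad F x != 0.
  move=> Kx aF; apply/eqP => gx0.
  have Ox : Omega1 (lsubmx x).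
    by apply: O1 Kx.1 _ => /(Fbd x Kx); rewrite ltNge aF.
  have [in2|nin2] := pselect (Omega2 (rsubmx x)).
    apply: no_crit; exists x => //; rewrite -(hsubmxK x).
    by exists (lsubmx x) => //; exists (rsubmx x).
  have [|rho _] := Fin x Ox; first by split; [exact: Kx.2|rewrite (interior_id _).1].
  by rewrite gx0 /dotp big1 ?ltxx// => i _; rewrite !mxE mulr0.
have [e [c [e0 c0 step]]] :=
  uniform_descent Omega1_open Omega2_open U_open cK KU F1 Fbd Fcrit Fin.
have [h [ch hK hbd hb]] := descent_section Omega2_nonempty cK KU F1 ab e0 c0 Fbd step.
(* The two formulas agree on the boundary of [Omega1], so [f] is continuous by
   pasting along the closed sets [closure Omega1] and [~` Omega1]. *)
pose f x := if x \in closure Omega1 then lsubmx (h x) else x.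
have f_in x : closure Omega1 x -> f x = lsubmx (h x).
  by move=> clx; rewrite /f mem_set.
have f_out x : ~ Omega1 x -> f x = x.
  move=> nOx; rewrite /f; case: ifPn => //; rewrite inE => clx.
  by rewrite hbd//; split=> //; rewrite (interior_id _).1.
have cf : continuous f.
  apply/continuous_subspace_setT.
  have -> : [set: 'rV[R]_n1] = closure Omega1 `|` ~` Omega1.
    apply/seteqP; split=> // x _; have [Ox|] := pselect (Omega1 x); last by right.
    by left; exact: subset_closure.
  apply: withinU_continuous; first exact: closed_closure.
  - exact: open_closedC.
  - apply: (@subspace_eq_continuous _ _ _ (lsubmx \o h)).
      by move=> x; rewrite inE => clx; apply/esym; exact: f_in.
    by apply: within_continuous_comp ch => y _; exact: continuous_lsubmx.
  - have cid : {within ~` Omega1, continuous (fun x : 'rV[R]_n1 => x)}.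
      by apply: continuous_subspaceT => x ? ?.
    apply: subspace_eq_continuous cid.
    by move=> x; rewrite inE => nOx; apply/esym; exact: f_out.
have [B OB] := bounded_closure Omega1_bounded.
have [|x fx] := @onto_of_id_outside_bounded R n1 f (B + 1) cf _ xbar.
  move=> x Bx; apply: f_out => /subset_closure/OB.
  by rewrite leNgt (lt_le_trans _ Bx)// ltrDl.
have clx : closure Omega1 x.
  apply: contrapT => nclx; have nOx : ~ Omega1 x by move/subset_closure.
  by apply: (nOx); rewrite -(f_out x nOx) fx.
have := Fb _ (hK x clx).2; rewrite -fx f_in// hsubmxK leNgt => /negP; apply.
exact: hb.
Qed.
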